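(* Let $r \geq 1$ be an integer and let $\mathcal{A}$ be a cluster algebra of Dynkin type $\mathbb{A}_r$. Then there is an isomorphism of $\mathbb{Z}$-algebras $$\mathcal{A} \simeq \mathbb{Z}[t_0, \ldots, t_{r}]/(P_{r+1}(t_0, \ldots, t_r)-1),$$ where $t_0, \ldots, t_{r}$ are indeterminates over $\mathbb{Z}$ and $P_{r+1}$ is the $(r+1)$-th generalized Chebyshev polynomial.
   Context: Generalized Chebyshev polynomials: $P_0=1$, $P_1(x_1)=x_1$, and for $n\ge 1$, $P_{n+1}(x_1,\ldots,x_{n+1})=x_{n+1}P_n(x_1,\ldots,x_n)-P_{n-1}(x_1,\ldots,x_{n-1})$; thus $P_n$ is a polynomial in $n$ variables with integer coefficients. Cluster algebras here are simply-laced and coefficient-free: for a finite quiver $Q$ with vertex set $Q_0$, without loops and 2-cycles, and a tuple $\mathbf{u}=(u_i)_{i\in Q_0}$ of indeterminates over $\mathbb{Q}$, the cluster algebra $\mathcal{A}(Q)$ is the subring of $\mathbb{Z}[\mathbf{u}^{\pm1}]$ generated by all cluster variables obtained from the initial seed $(Q,\mathbf{u})$ by iterated mutations (no frozen variables). It is of Dynkin type $\mathbb{A}_r$ if $Q$ is mutation-equivalent to an orientation of the Dynkin diagram $\mathbb{A}_r$ (with $r$ vertices). *)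

(* Defs.v *)
From HB Require Import structures.
From mathcomp Require Import all_boot all_algebra ring_quotient.
From mathcomp Require Import mpoly.
From mathcomp Require Import boolp.

Set Implicit Arguments.
Unset Strict Implicit.
Unset Printing Implicit Defensive.

Import GRing.Theory.
Local Open Scope ring_scope.

(* [arrows i j] is the number of arrows i -> j. *)
Record quiver (V : finType) := Quiver {
  arrows :> V -> V -> nat;
  quiver_loopless : forall i, arrows i i == 0%N;
  quiver_no_2cycle : forall i j, (arrows i j == 0%N) || (arrows j i == 0%N)
}.

Section QuiverMutation.
Variable V : finType.
Implicit Types (Q : quiver V) (i j k : V).

(* Each path i -> k -> j contributes a new arrow i -> j; meant for i, j
   distinct from k. *)
Definition arrows_with_paths Q k i j : nat := (Q i j + Q i k * Q k j)%N.

(* The truncated subtraction removes a maximal set of pairwise disjoint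
   2-cycles. *)
Definition mutate_arrows Q k i j : nat :=
  if (i == k) || (j == k) then Q j i
  else (arrows_with_paths Q k i j - arrows_with_paths Q k j i)%N.

Lemma mutate_loopless Q k i : mutate_arrows Q k i i == 0%N.
Proof.
rewrite /mutate_arrows subnn; case: ifP => // _; exact: quiver_loopless.
Qed.

Lemma mutate_no_2cycle Q k i j :
  (mutate_arrows Q k i j == 0%N) || (mutate_arrows Q k j i == 0%N).
Proof.
rewrite /mutate_arrows [(j == k) || _]orbC; case: ifP => _.
  exact: quiver_no_2cycle.
by rewrite !subn_eq0 leq_total.
Qed.

Definition mutate_quiver Q k : quiver V :=
  Quiver (mutate_loopless Q k) (mutate_no_2cycle Q k).

End QuiverMutation.

Definition quiver_iso (V W : finType) (Q : quiver V) (Q' : quiver W) : Prop :=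
  exists2 f : V -> W, bijective f & forall i j, Q i j = Q' (f i) (f j).

Definition mutation_equivalent (V W : finType) (Q : quiver V) (Q' : quiver W)
    : Prop :=
  exists ks : seq V, quiver_iso (foldl (@mutate_quiver V) Q ks) Q'.

Definition orientation_of_A (r : nat) (Q : quiver 'I_r) : Prop :=
  forall i j : 'I_r,
    (Q i j + Q j i)%N = ((i.+1 == j :> nat) || (j.+1 == i :> nat)).

Definition dynkin_type_A (V : finType) (Q : quiver V) (r : nat) : Prop :=
  exists2 Q' : quiver 'I_r, orientation_of_A Q' & mutation_equivalent Q Q'.

Inductive generated_subring (R : pzRingType) (S : R -> Prop) : R -> Prop :=
| generated_gen x : S x -> generated_subring S x
| generated_one : generated_subring S 1
| generated_sub x y :
    generated_subring S x -> generated_subring S y ->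
    generated_subring S (x - y)
| generated_mul x y :
    generated_subring S x -> generated_subring S y ->
    generated_subring S (x * y).

Section ClusterAlgebra.
Variable V : finType.

(* The field Q(u), with one indeterminate for each vertex. *)
Definition ambient_field : fieldType := {fraction {mpoly rat[#|V|]}}.

Definition initial_variable (i : V) : ambient_field := tofrac 'X_(enum_rank i).

Record seed := Seed {
  seed_quiver : quiver V;
  seed_cluster : V -> ambient_field
}.

Definition exchange_variable (s : seed) (k : V) : ambient_field :=
  let Q := seed_quiver s in
  let x := seed_cluster s in
  (\prod_i x i ^+ Q i k + \prod_i x i ^+ Q k i) / x k.

Definition mutate_seed (s : seed) (k : V) : seed :=
  Seed (mutate_quiver (seed_quiver s) k)
       (fun i => if i == k then exchange_variable s k else seed_cluster s i).

Variable Q : quiver V.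

Definition initial_seed : seed := Seed Q initial_variable.

Definition is_cluster_variable (x : ambient_field) : Prop :=
  exists (ks : seq V) (i : V),
    x = seed_cluster (foldl mutate_seed initial_seed ks) i.

(* By the Laurent phenomenon, the subring of Q(u) generated by the cluster
   variables is contained in Z[u^{+-1}]. *)
Definition in_cluster_algebra : {pred ambient_field} :=
  [pred x | `[< generated_subring is_cluster_variable x >]].

Lemma in_cluster_algebra_closed : subring_closed in_cluster_algebra.
Proof.
split=> [|x y|x y]; rewrite !inE.
- by apply/asboolP/generated_one.
- by move=> /asboolP xA /asboolP yA; apply/asboolP/generated_sub.
- by move=> /asboolP xA /asboolP yA; apply/asboolP/generated_mul.
Qed.

Record cluster_algebra := ClusterAlgebra {
  cluster_algebra_val : ambient_field;
  cluster_algebra_valP : cluster_algebra_val \in in_cluster_algebra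
}.

HB.instance Definition _ := [isSub for cluster_algebra_val].
HB.instance Definition _ := [Choice of cluster_algebra by <:].
HB.instance Definition _ :=
  GRing.SubChoice_isSubComNzRing.Build ambient_field in_cluster_algebra
    cluster_algebra in_cluster_algebra_closed.

End ClusterAlgebra.

(* The pair (P_n, P_{n+1}).  Variables are numbered from 0, and [mwiden] views
   a polynomial in n variables as one in n.+1 variables, the last of which
   does not occur. *)
Fixpoint chebyshev_pair (n : nat) : {mpoly int[n]} * {mpoly int[n.+1]} :=
  match n with
  | 0 => (1, 'X_ord0)
  | m.+1 =>
      let: (p, q) := chebyshev_pair m in
      (q, 'X_ord_max * mwiden q - mwiden (mwiden p))
  end.

Definition chebyshev (n : nat) : {mpoly int[n]} := (chebyshev_pair n).1.

Lemma chebyshev0 : chebyshev 0 = 1.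
Proof. by []. Qed.

Lemma chebyshev1 : chebyshev 1 = 'X_ord0.
Proof. by []. Qed.

Lemma chebyshev_pair2 n : (chebyshev_pair n).2 = chebyshev n.+1.
Proof. by rewrite /chebyshev /=; case: (chebyshev_pair n). Qed.

Lemma chebyshevSS n :
  chebyshev n.+2 =
  'X_ord_max * mwiden (chebyshev n.+1) - mwiden (mwiden (chebyshev n)).
Proof.
by rewrite -(chebyshev_pair2 n) /chebyshev /=; case: (chebyshev_pair n).
Qed.

Section ChebyshevQuotient.
Variable r : nat.

(* The principal ideal (P_{r+1} - 1) of Z[t_0, ..., t_r]. *)
Definition chebyshev_ideal : {pred {mpoly int[r.+1]}} :=
  [pred p | `[< exists q, p = q * (chebyshev r.+1 - 1) >]].

(* P_n takes the value 1 at (1, 2, 2, ...), so the ideal is proper. *)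
Definition chebyshev_point (n : nat) (i : 'I_n) : int :=
  if i == 0%N :> nat then 1 else 2.

Lemma meval_mwiden n (v : 'I_n.+1 -> int) (p : {mpoly int[n]}) :
  (mwiden p).@[v] = p.@[fun i => v (widen_ord (leqnSn n) i)].
Proof.
rewrite /mwiden {1}/mmap raddf_sum /= mevalE; apply: eq_bigr => m _.
rewrite mevalM mevalC /mmap1 rmorph_prod; congr (_ * _).
by apply: eq_bigr => i _; rewrite rmorphXn /= mevalXU.
Qed.

Lemma meval_chebyshev n : (chebyshev n).@[@chebyshev_point n] = 1.
Proof.
suff [] : (chebyshev n).@[@chebyshev_point n] = 1 /\
          (chebyshev n.+1).@[@chebyshev_point n.+1] = 1 by [].
elim: n => [|n [IH0 IH1]]; first by rewrite meval1 mevalXU.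
split=> //; rewrite chebyshevSS mevalB mevalM mevalXU !meval_mwiden.
by rewrite [X in _ * X]IH1 [X in _ - X]IH0.
Qed.

Lemma chebyshev_ideal_closed : idealr_closed chebyshev_ideal.
Proof.
split; rewrite ?inE.
- by apply/asboolP; exists 0; rewrite mul0r.
- apply/asboolP => -[q /(congr1 (meval (@chebyshev_point r.+1)))].
  by rewrite mevalM mevalB meval_chebyshev !meval1 subrr mulr0.
- move=> a x y; rewrite !inE => /asboolP[q ->] /asboolP[q' ->]; apply/asboolP.
  by exists (a * q + q'); rewrite mulrDl mulrA.
Qed.

HB.instance Definition _ :=
  isIdealr.Build {mpoly int[r.+1]} chebyshev_ideal chebyshev_ideal_closed.

Definition chebyshev_quotient : comNzRingType :=
  {ideal_quot (chebyshev_ideal : idealr _)}.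

End ChebyshevQuotient.

(* Main.v *)
Require Import Defs.
From HB Require Import structures.
From mathcomp Require Import all_boot all_algebra ring_quotient mpoly boolp.
From mathcomp Require Import zify ring.

(** Let v_0 = (1, 0), v_1 = (0, 1) and v_{j+2} = t_j v_{j+1} - v_j, for j <= r.
    Regard v_0, ..., v_{r+2} as the vertices of an (r+3)-gon, the chord {i, j}
    with i < j carrying the determinant of v_i and v_j.  The sides {j, j+1}
    carry 1, the chord {0, j} carries P_{j-1}(t_0, ..., t_{j-2}), and hence the
    relation P_{r+1} = 1 says that the last side {0, r+2} carries 1 as well.
    Determinants of vectors in a plane satisfy the Ptolemy relation, which is
    the exchange relation of type A_r: clusters are triangulations, mutations
    are flips, and the cluster algebra is generated by the t_j.

    To make this a proof, mutate the given quiver to the linear orientation of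
    A_r ([linear_orientation]), and let u_1, ..., u_r be the cluster of the seed
    so obtained.  With u_0 = u_{r+1} = 1 and u_{-1} = 0, the elements
    t_j = (u_{j+1} + u_{j-1}) / u_j of Q(u) satisfy P_j(t) = u_j; they define a
    ring morphism [fan_eval] from Z[t_0, ..., t_r] to Q(u), and two facts remain.

    Its image is the cluster algebra ([fan_eval_image]).  On the one hand
    t_0 = u_1, and t_j is the variable that the mutation at u_j creates.  On the
    other hand the seed u is the fan triangulation at the vertex 0, a flip turns
    a seed given by a triangulation into another one ([triangulated_mutate]),
    and every chord is a polynomial in the t_j because the coordinates of the
    vectors v_j are.

    Its kernel is generated by P_{r+1} - 1 ([fan_eval_kernel]).  If f lies in the
    kernel, clear denominators: there are a monomial m and a polynomial g in the
    u_j with m(u) f(t) = g(u) in Q(u), and also m(P) f = g(P) modulo P_{r+1} - 1.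
    The u_j are algebraically independent, so g = 0, and it remains to cancel
    m(P), that is, to see that P_1, ..., P_r are not zero divisors modulo
    P_{r+1} - 1 ([continuant_cancel]).  As P_k does not divide P_{r+1} - 1, this
    follows once P_k is known to be prime.  Now P_k = t_{k-1} P_{k-1} -
    P_{k-2}, and P_{k-1} is a unit modulo P_k, so that substituting
    P_{k-2} / P_{k-1} for t_{k-1} embeds Z[t] / (P_k) in a field; this is a second
    instance of clearing denominators ([clear_denominators]).  A third one shows
    that algebraic independence survives mutation. *)

Set Implicit Arguments.
Unset Strict Implicit.
Unset Printing Implicit Defensive.

Import GRing.Theory.
Local Open Scope ring_scope.

(** * Polynomials with integer coefficients *)

Lemma mpoly_int_ind n (P : {mpoly int[n]} -> Prop) :
  P 1 -> (forall p q, P p -> P q -> P (p - q)) ->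
  (forall p q, P p -> P q -> P (p * q)) -> (forall i, P 'X_i) -> forall p, P p.
Proof.
move=> P1 PB PM PX.
have P0 : P 0 by rewrite -(subrr 1); exact: PB.
have PN p : P p -> P (- p) by rewrite -sub0r; exact: PB.
have PD p q : P p -> P q -> P (p + q).
  by move=> Pp Pq; have := PB _ _ Pp (PN _ Pq); rewrite opprK.
have PS I (s : seq I) F : (forall i, P (F i)) -> P (\sum_(i <- s) F i).
  by move=> PF; apply: (big_ind P).
have PC c : P c%:MP.
  have PCn k : P (k%:Z)%:MP.
    elim: k => [|k IH]; first by rewrite mpolyC0.
    by rewrite -addn1 PoszD mpolyCD; apply: PD.
  by case: (intP c) => [|k|k]; rewrite ?mpolyCN; try apply: PN; apply: PCn.
move=> p; rewrite [p]mpolyE; apply: PS => m; rewrite -mul_mpolyC; apply: (PM) => //.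
rewrite mpolyXE_id; apply: (big_ind P P1 PM) => i _.
by elim: (m i) => [|k IH]; rewrite ?expr0 // exprS; apply: PM.
Qed.

Definition int_eval (R : comNzRingType) n (v : 'I_n -> R) (p : {mpoly int[n]}) : R :=
  mmap (intmul 1) v p.

HB.instance Definition _ (R : comNzRingType) n (v : 'I_n -> R) :=
  GRing.RMorphism.copy (int_eval v) (mmap (intmul 1) v).

Lemma int_evalX (R : comNzRingType) n (v : 'I_n -> R) i : int_eval v 'X_i = v i.
Proof. by rewrite /int_eval mmapX mmap1U. Qed.

Lemma int_eval_unique (R : comNzRingType) n (f g : {rmorphism {mpoly int[n]} -> R}) :
  (forall i, f 'X_i = g 'X_i) -> f =1 g.
Proof.
move=> fgX; apply: mpoly_int_ind => // [|p q fgp fgq|p q fgp fgq].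
- by rewrite !rmorph1.
- by rewrite !rmorphB fgp fgq.
- by rewrite !rmorphM fgp fgq.
Qed.

(** The kernel of [phi] is computed from fractions. If every variable
    becomes an element of G, embedded by [iota], after multiplication by
    some s in G, then so does every polynomial, since such s are stable
    under products. When [rho] and [pi] obey the same equations modulo J,
    where the multipliers can be cancelled, a polynomial killed by [phi] has
    numerator 0 in G, whence its image by [rho] is in J. *)
Lemma clear_denominators n (A := {mpoly int[n]}) (G C K : comNzRingType)
    (phi : {rmorphism A -> K}) (rho : {rmorphism A -> C})
    (iota : {rmorphism G -> K}) (pi : {rmorphism G -> C}) (J : C -> Prop) :
  J 0 -> (forall x y, J x -> J y -> J (x - y)) -> (forall c x, J x -> J (c * x)) ->
  injective iota ->
  (forall i, exists s g, [/\ forall c, J (pi s * c) -> J c,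
     iota s * phi 'X_i = iota g & J (pi s * rho 'X_i - pi g)]) ->
  forall p, phi p = 0 -> J (rho p).
Proof.
move=> J0 JB JM iota_inj genJ.
have JN x : J x -> J (- x) by rewrite -mulN1r; exact: JM.
(* The multipliers s that can be cancelled modulo J form a monoid, which is why
   the property passes to differences and products. *)
have clear p : exists s g, [/\ forall c, J (pi s * c) -> J c,
     iota s * phi p = iota g & J (pi s * rho p - pi g)].
  elim/mpoly_int_ind: p => // [|p q [s [g [sJ sp Jp]]] [s' [g' [s'J sq Jq]]]
                               |p q [s [g [sJ sp Jp]]] [s' [g' [s'J sq Jq]]]].
  - exists 1, 1; split=> [c||]; rewrite ?rmorph1 ?mul1r //.
    by rewrite subrr.
  - exists (s * s'), (g * s' - g' * s); split=> [c||].
    + by rewrite rmorphM -mulrA => /sJ/s'J.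
    + rewrite !rmorphM !rmorphB !rmorphM -sp -sq; ring.
    + rewrite !rmorphM !rmorphB !rmorphM.
      have -> : pi s * pi s' * (rho p - rho q) - (pi g * pi s' - pi g' * pi s)
          = pi s' * (pi s * rho p - pi g) - pi s * (pi s' * rho q - pi g') by ring.
      by apply: JB; apply: JM.
  - exists (s * s'), (g * g'); split=> [c||].
    + by rewrite rmorphM -mulrA => /sJ/s'J.
    + rewrite !rmorphM -sp -sq; ring.
    + rewrite !rmorphM.
      have -> : pi s * pi s' * (rho p * rho q) - pi g * pi g' =
          (pi s' * rho q) * (pi s * rho p - pi g)
          - - (pi g * (pi s' * rho q - pi g')) by ring.
      by apply: JB; [|apply: JN]; apply: JM.
move=> p phip; have [s [g [sJ + +]]] := clear p.
rewrite phip mulr0 -(rmorph0 iota) => /iota_inj <-.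
by rewrite rmorph0 subr0 => /sJ.
Qed.

(** * Continuants *)

(** The second order recurrence of parameters t started at s0, s1. Its two
    fundamental solutions are the coordinates of the vertices v_j of the
    polygon. *)
Fixpoint chain (R : comNzRingType) (s0 s1 : R) (t : nat -> R) (j : nat) : R :=
  match j with
  | 0 => s0
  | (k.+1 as j').+1 => t k * chain s0 s1 t j' - chain s0 s1 t k
  | 1 => s1
  end.

Arguments chain : simpl never.

Notation continuant := (chain 0 1).
Notation cocontinuant := (chain 1 0).

Section Chain.
Variable R : comNzRingType.
Implicit Types (s : R) (t : nat -> R).

Lemma chainSS s0 s1 t j :
  chain s0 s1 t j.+2 = t j * chain s0 s1 t j.+1 - chain s0 s1 t j.
Proof. by []. Qed.

Lemma nat_ind2 (P : nat -> Prop) :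
  P 0%N -> P 1%N -> (forall j, P j -> P j.+1 -> P j.+2) -> forall j, P j.
Proof.
move=> P0 P1 PS j; suff [] : P j /\ P j.+1 by [].
by elim: j => // j [Pj PSj]; split; last exact: PS.
Qed.

Lemma eq_chain s0 s1 t t' n : (forall i, (i.+1 < n)%N -> t i = t' i) ->
  forall j, (j <= n)%N -> chain s0 s1 t j = chain s0 s1 t' j.
Proof.
move=> eqt; elim/nat_ind2 => // j IH0 IH1 lt_jn.
by rewrite !chainSS eqt // IH0 ?IH1 //; lia.
Qed.

(** Consecutive vertices of the polygon have determinant 1: the transition
    matrices of the recurrence have determinant 1. *)
Lemma chain_det t j :
  cocontinuant t j * continuant t j.+1 - cocontinuant t j.+1 * continuant t j = 1.
Proof.
elim: j => [|j IH]; first by rewrite /chain; ring.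
by rewrite -[RHS]IH !chainSS; ring.
Qed.

End Chain.

Lemma rmorph_chain (R S : comNzRingType) (f : {rmorphism R -> S}) s0 s1 t j :
  f (chain s0 s1 t j) = chain (f s0) (f s1) (f \o t) j.
Proof. by elim/nat_ind2: j => // j IH0 IH1; rewrite !chainSS rmorphB rmorphM IH0 IH1. Qed.

Lemma rmorph_continuant (R S : comNzRingType) (f : {rmorphism R -> S}) t j :
  f (continuant t j) = continuant (f \o t) j.
Proof. by rewrite rmorph_chain rmorph0 rmorph1. Qed.

(** In characteristic zero, a point where no continuant of positive index
    vanishes. *)
Lemma continuant2 (R : comNzRingType) j :
  continuant (fun=> 2 : R) j = j%:R.
Proof.
elim/nat_ind2: j => // j IH0 IH1; rewrite chainSS IH0 IH1 !mulrS; ring.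
Qed.

Section Polynomials.
Variable r : nat.
Local Notation A := {mpoly int[r.+1]}.

(** The variables as a sequence indexed by nat, as [chain] expects; the
    value beyond t_r is a default. *)
Definition variable_seq (j : nat) : A := if (j < r.+1)%N then 'X_(inord j) else 0.

Local Notation P := (continuant variable_seq).

Lemma variable_seqE (i : 'I_r.+1) : variable_seq i = 'X_i.
Proof. by rewrite /variable_seq ltn_ord inord_val. Qed.

Lemma int_eval_variable_seq (R : comNzRingType) (t : nat -> R) j :
  (j < r.+1)%N -> int_eval (fun i : 'I_r.+1 => t i) (variable_seq j) = t j.
Proof. by move=> lt_jr; rewrite /variable_seq lt_jr int_evalX inordK. Qed.

Lemma int_eval_continuant (R : comNzRingType) (t : nat -> R) j :
  (j <= r.+2)%N -> int_eval (fun i : 'I_r.+1 => t i) (P j) = continuant t j.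
Proof.
move=> le_jr; rewrite rmorph_continuant; apply: (@eq_chain _ _ _ _ _ r.+2) => // i lt_ir.
by rewrite /= int_eval_variable_seq.
Qed.

End Polynomials.

Lemma int_eval_mwiden (R : comNzRingType) n (v : 'I_n.+1 -> R) p :
  int_eval v (mwiden p) = int_eval (fun i => v (widen_ord (leqnSn n) i)) p.
Proof.
apply: (int_eval_unique (f := int_eval v \o @mwiden n int)) => i /=.
by rewrite mwidenX mnmwiden1 !int_evalX.
Qed.

Lemma int_eval_chebyshev (R : comNzRingType) (t : nat -> R) n :
  int_eval (fun i : 'I_n => t i) (chebyshev n) = continuant t n.+1.
Proof.
elim/nat_ind2: n => [||n IH0 IH1]; first by rewrite chebyshev0 rmorph1.
  by rewrite chebyshev1 int_evalX chainSS /chain; ring.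
rewrite chebyshevSS chainSS -IH0 -IH1 rmorphB rmorphM /= int_evalX.
by rewrite !int_eval_mwiden.
Qed.

(** The index is shifted by one because [continuant] starts with the values
    0 and 1, that is, with P_{-1} and P_0. *)
Lemma chebyshevE r : chebyshev r.+1 = continuant (variable_seq r) r.+2.
Proof.
rewrite -int_eval_chebyshev.
apply: (int_eval_unique (f := idfun)
  (g := int_eval (fun i : 'I_r.+1 => variable_seq r i))) => i.
by rewrite /= int_evalX variable_seqE.
Qed.

(** * Continuants are prime to the defining relation *)

Lemma tofrac_inj (R : idomainType) : injective (@tofrac R).
Proof. by move=> x y /eqP; rewrite tofrac_eq => /eqP. Qed.

(** The parameters 1, 2, ..., 2, 1, 2, 2, ... (or 0, 2, 2, ... for c = 0),
    with the drop at the index c, for which the continuants are 0, 1, ...,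
    1, 0, -1, -2, ... *)
Definition vanishing_point (c j : nat) : int := 2 - (j == 0%N)%:Z - (j == c)%:Z.

Lemma continuant_vanishing_point c j :
  continuant (vanishing_point c) j.+1 = (j <= c)%:Z - (j - c.+1)%N%:Z.
Proof.
suff [] : continuant (vanishing_point c) j.+1 = (j <= c)%:Z - (j - c.+1)%N%:Z /\
    continuant (vanishing_point c) j.+2 = (j.+1 <= c)%:Z - (j.+1 - c.+1)%N%:Z by [].
elim: j => [|j [IH0 IH1]].
  by rewrite chainSS /chain /vanishing_point; case: c => [|c] //=; rewrite ?mulr1.
split=> //; rewrite chainSS IH0 IH1 /vanishing_point.
case: (ltngtP j.+1 c) => //= ?; lia.
Qed.

Section Regularity.
Variable r : nat.
Local Notation A := {mpoly int[r.+1]}.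
Local Notation T := (variable_seq r).
Local Notation P := (continuant T).

Lemma continuant_variable_neq0 j : (0 < j <= r.+2)%N -> P j != 0.
Proof.
move=> /andP[j_gt0 le_jr]; apply/eqP => /(congr1 (int_eval (fun i : 'I_r.+1 => 2 : int))).
rewrite (int_eval_continuant (fun=> 2)) // continuant2 rmorph0 => /eqP.
by rewrite natz; lia.
Qed.

(** The continuant of index c+2 is P_{c+1}; it is prime and does not divide
    P_{r+1} - 1. Both assertions are read off the morphism [chi], the
    solution of P_{c+1} = 0 for the variable t_c. *)
Lemma continuant_regular c q h : (c < r)%N ->
  P c.+2 * h = q * (P r.+2 - 1) -> exists y, q = y * P c.+2.
Proof.
move=> lt_cr eq_h.
have Pc_neq0 : tofrac (P c.+1) != 0.
  by rewrite tofrac_eq0 continuant_variable_neq0 //=; lia.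
pose t j := if j == c then tofrac (P c) / tofrac (P c.+1) else tofrac (T j).
pose chi : {rmorphism A -> _} := int_eval (fun i : 'I_r.+1 => t i).
pose J (x : A) := exists y, x = y * P c.+2.
have chiP j : (j <= c.+1)%N -> chi (P j) = tofrac (P j).
  move=> le_jc; rewrite /chi /= int_eval_continuant; last lia.
  rewrite rmorph_continuant; apply: (@eq_chain _ _ _ _ _ c.+1) => // i lt_ic.
  by rewrite /t /= ltn_eqF.
have chi0 : chi (P c.+2) = 0.
  rewrite chainSS rmorphB rmorphM !chiP //= int_eval_variable_seq; last lia.
  by rewrite /t eqxx divfK // subrr.
have chi_ker p : chi p = 0 -> J p.
  apply: (clear_denominators (rho := idfun) (iota := @tofrac _) (pi := idfun)) => //=.
  - by exists 0; rewrite mul0r.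
  - by move=> _ _ [y ->] [z ->]; exists (y - z); rewrite mulrBl.
  - by move=> a _ [y ->]; exists (a * y); rewrite mulrA.
  - exact: tofrac_inj.
  - move=> i; case: (eqVneq (i : nat) c) => [eq_ic|neq_ic].
      (* [chain_det] says that P c.+1 is a unit modulo P c.+2. *)
      exists (P c.+1), (P c); split=> [x [y eq_y]||].
      + exists (cocontinuant T c.+1 * x - cocontinuant T c.+2 * y).
        rewrite -[LHS]mul1r -[in LHS](chain_det T c.+1) mulrBl.
        by rewrite -[X in _ - X]mulrA eq_y; ring.
      + by rewrite int_evalX /t eq_ic eqxx mulrC divfK.
      + by exists 1; rewrite mul1r chainSS -eq_ic variable_seqE mulrC.
    exists 1, 'X_i; split=> [x||]; rewrite ?mul1r //.
      by rewrite int_evalX /t (negPf neq_ic) variable_seqE.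
    by exists 0; rewrite subrr mul0r.
(* At [vanishing_point] the continuant of index c.+2 is zero, whereas
   the one of index r.+2 is negative, hence different from 1. *)
have chiD : chi (P r.+2 - 1) != 0.
  apply/eqP => /chi_ker[y /(congr1 (int_eval (fun i : 'I_r.+1 => vanishing_point c i)))].
  rewrite rmorphB rmorph1 rmorphM /= !int_eval_continuant //; last lia.
  rewrite !continuant_vanishing_point.
  by move: (int_eval _ y) => z; nia.
have := congr1 chi eq_h; rewrite !rmorphM chi0 mul0r => /esym/eqP.
by rewrite mulf_eq0 (negPf chiD) orbF => /eqP/chi_ker.
Qed.

Lemma continuant_cancel c h : (c <= r)%N ->
  (exists q, P c.+1 * h = q * (P r.+2 - 1)) -> exists q, h = q * (P r.+2 - 1).
Proof.
case: c => [|c] lt_cr [q eq_q]; first by exists q; rewrite -eq_q mul1r.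
have [y q_y] := continuant_regular lt_cr eq_q; exists y.
apply: (mulfI (x := P c.+2)); first by apply: continuant_variable_neq0; lia.
by rewrite eq_q q_y; ring.
Qed.

End Regularity.

(** * Algebraic independence of clusters *)

Section Quivers.
Variable V : finType.
Implicit Types (Q : quiver V) (i j k : V).

Lemma quiver_ext Q Q' : (forall i j, Q i j = Q' i j) -> Q = Q'.
Proof.
case: Q Q' => [q qL qC] [q' qL' qC'] /= eq_qq'.
have {}eq_qq' : q = q' by apply/funext => i; apply/funext => j.
rewrite {}eq_qq' in qL qC *.
by congr Quiver; apply: Prop_irrelevance.
Qed.

(** Mutating again adds the paths in the opposite direction, which restores
    the cancelled arrows; the absence of 2-cycles makes the truncated
    differences exact. *)
Lemma mutate_quiverK k : involutive (@mutate_quiver V ^~ k).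
Proof.
move=> Q; apply: quiver_ext => i j /=; rewrite /mutate_arrows /=.
case: ifP => [ik_jk|/norP[ik jk]]; first by rewrite /mutate_arrows orbC ik_jk.
rewrite /arrows_with_paths /= /mutate_arrows eqxx (negPf ik) (negPf jk) /=.
rewrite /arrows_with_paths.
by case/orP: (quiver_no_2cycle Q i j) => /eqP ->; lia.
Qed.

End Quivers.

Section Independence.
Variables (V : finType) (K : fieldType).
Implicit Types x : V -> K.

Definition cluster_eval (R : comNzRingType) (x : V -> R) : {mpoly int[#|V|]} -> R :=
  int_eval (fun i : 'I_#|V| => x (enum_val i)).

HB.instance Definition _ (R : comNzRingType) (x : V -> R) :=
  GRing.RMorphism.copy (cluster_eval x) (int_eval (fun i : 'I_#|V| => x (enum_val i))).

Lemma cluster_evalX (R : comNzRingType) (x : V -> R) v :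
  cluster_eval x 'X_(enum_rank v) = x v.
Proof. by rewrite /cluster_eval int_evalX enum_rankK. Qed.

Definition alg_independent x := forall p, cluster_eval x p = 0 -> p = 0.

Lemma alg_independent_inj x : alg_independent x -> injective (cluster_eval x).
Proof.
by move=> xI p q /eqP; rewrite -subr_eq0 -rmorphB => /eqP/xI/eqP; rewrite subr_eq0 => /eqP.
Qed.

Lemma alg_independent_neq0 x v : alg_independent x -> x v != 0.
Proof.
move=> xI; apply/eqP; rewrite -cluster_evalX => /xI.
move=> /(congr1 (cluster_eval (fun=> 1 : int))).
by rewrite cluster_evalX rmorph0.
Qed.

Lemma alg_independent_neq1 x v : alg_independent x -> x v != 1.
Proof.
move=> xI; apply/eqP; rewrite -cluster_evalX -(rmorph1 (cluster_eval x)).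
move=> /(alg_independent_inj xI)/(congr1 (cluster_eval (fun=> 0 : int))).
by rewrite cluster_evalX rmorph1.
Qed.

Lemma alg_independent_injective x : alg_independent x -> injective x.
Proof.
move=> xI v w; rewrite -!cluster_evalX => /(alg_independent_inj xI).
move=> /(congr1 (cluster_eval (fun u => (u == v)%:R : int))).
by rewrite !cluster_evalX eqxx; case: eqVneq.
Qed.

(** Since x k * x' k = N, where N does not involve the index k, the
    substitution that leads from x to x' is its own inverse. If p vanishes
    at x', then so does its numerator g at x, hence g = 0; substituting
    back, a nonzero multiple of the value of p at x is the value of g at x',
    so that p vanishes at x as well. *)
Lemma alg_independent_exchange x k (N : {mpoly int[#|V|]}) :
  N != 0 ->
  (forall x', (forall i, i != k -> x' i = x i) -> cluster_eval x' N = cluster_eval x N) ->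
  alg_independent x ->
  alg_independent (fun i => if i == k then cluster_eval x N / x k else x i).
Proof.
move=> N_neq0 Nk xI; set x' := fun i => _.
have x'N : cluster_eval x' N = cluster_eval x N.
  by apply: Nk => i /negPf; rewrite /x' => ->.
have xk_neq0 := alg_independent_neq0 k xI.
have xN_neq0 : cluster_eval x N != 0 by apply: contra_neq N_neq0 => /xI.
have mul_x' : x k * x' k = cluster_eval x N by rewrite /x' eqxx mulrC divfK.
move=> p /(clear_denominators (rho := cluster_eval x) (iota := cluster_eval x)
  (pi := cluster_eval x') (J := fun y => y = 0)) x'p.
apply/xI/x'p => // [_ _ -> ->|c _ ->||i]; rewrite ?subr0 ?mulr0 //.
  exact: alg_independent_inj.
rewrite -(enum_valK i); case: (eqVneq (enum_val i) k) => [->|ik].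
  exists 'X_(enum_rank k), N; rewrite /= !cluster_evalX mul_x' x'N mulrC mul_x' subrr.
  split=> // c /eqP; rewrite mulf_eq0 /x' eqxx mulf_eq0 invr_eq0.
  by rewrite (negPf xN_neq0) (negPf xk_neq0) => /eqP.
exists 1, 'X_(enum_rank (enum_val i)).
by split=> [c||]; rewrite ?rmorph1 ?mul1r //= !cluster_evalX /x' (negPf ik) ?subrr.
Qed.

End Independence.

Section Seeds.
Variable V : finType.
Implicit Types (s : seed V) (k : V).

Lemma alg_independent_initial (Q : quiver V) :
  alg_independent (seed_cluster (initial_seed Q)).
Proof.
move=> p; rewrite /= (int_eval_unique (f := cluster_eval (@initial_variable V))
  (g := @tofrac _ \o map_mpoly (intmul 1 : int -> rat))) => [/=|i]; last first.
  by rewrite /= map_mpolyX /cluster_eval int_evalX /initial_variable enum_valK.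
rewrite -[X in _ = X]tofrac0 => /tofrac_inj p0; apply/mpolyP => m.
have := congr1 (mcoeff m) p0.
by rewrite mcoeff_map_mpoly !mcoeff0 => /eqP; rewrite intr_eq0 => /eqP.
Qed.

Definition exchange_numerator s k : {mpoly int[#|V|]} :=
  \prod_i 'X_(enum_rank i) ^+ seed_quiver s i k
  + \prod_i 'X_(enum_rank i) ^+ seed_quiver s k i.

Lemma eval_exchange_numerator (R : comNzRingType) s k (x : V -> R) :
  cluster_eval x (exchange_numerator s k) =
  \prod_i x i ^+ seed_quiver s i k + \prod_i x i ^+ seed_quiver s k i.
Proof.
rewrite rmorphD !rmorph_prod.
by congr (_ + _); apply: eq_bigr => i _; rewrite rmorphXn /= cluster_evalX.
Qed.

Lemma exchange_numerator_neq0 s k : exchange_numerator s k != 0.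
Proof.
apply/eqP => /(congr1 (cluster_eval (fun=> 1 : int))).
by rewrite eval_exchange_numerator rmorph0 !big1 // => i _; rewrite expr1n.
Qed.

Lemma exchange_numerator_const (R : comNzRingType) s k (x x' : V -> R) :
  (forall i, i != k -> x' i = x i) ->
  cluster_eval x' (exchange_numerator s k) = cluster_eval x (exchange_numerator s k).
Proof.
move=> eqx; rewrite !eval_exchange_numerator.
congr (_ + _); apply: eq_bigr => i _; case: (eqVneq i k) => [->|/eqx->//].
  by rewrite (eqP (quiver_loopless _ _)).
by rewrite (eqP (quiver_loopless _ _)).
Qed.

Lemma exchange_variableE s k :
  exchange_variable s k = cluster_eval (seed_cluster s) (exchange_numerator s k) / seed_cluster s k.
Proof. by rewrite eval_exchange_numerator. Qed.

Lemma alg_independent_mutate s k :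
  alg_independent (seed_cluster s) -> alg_independent (seed_cluster (mutate_seed s k)).
Proof.
move=> sI.
have := alg_independent_exchange (exchange_numerator_neq0 s k)
  (fun x' => @exchange_numerator_const _ s k _ x') sI.
by rewrite -exchange_variableE.
Qed.

Lemma alg_independent_foldl s ks :
  alg_independent (seed_cluster s) ->
  alg_independent (seed_cluster (foldl (@mutate_seed V) s ks)).
Proof.
elim: ks s => [|k ks IH] s sI; first exact: sI.
by apply: IH; apply: alg_independent_mutate.
Qed.

Lemma mutate_seedK s k :
  alg_independent (seed_cluster s) -> mutate_seed (mutate_seed s k) k = s.
Proof.
move=> sI; case: s sI => Q x /= xI; rewrite /mutate_seed /= mutate_quiverK.
congr Seed; apply/funext => i; case: eqVneq => [->|//].
rewrite exchange_variableE /= eqxx exchange_variableE.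
set s := Seed Q x; set s' := Seed _ _.
have -> : cluster_eval (seed_cluster s') (exchange_numerator s' k) =
          cluster_eval x (exchange_numerator s k).
  rewrite (@exchange_numerator_const _ s' k x); last by move=> j /negPf jk; rewrite /s' /= jk.
  rewrite !eval_exchange_numerator addrC.
  by congr (_ + _); apply: eq_bigr => j _; rewrite /= /mutate_arrows eqxx ?orbT.
rewrite invf_div mulrC divfK //.
by apply: contra_neq (exchange_numerator_neq0 s k) => /xI.
Qed.

Lemma foldl_mutate_seedK s ks : alg_independent (seed_cluster s) ->
  foldl (@mutate_seed V) (foldl (@mutate_seed V) s ks) (rev ks) = s.
Proof.
elim: ks s => [|k ks IH] s sI; first by [].
rewrite rev_cons [foldl _ s _]/=.
by rewrite foldl_rcons IH ?mutate_seedK //; apply: alg_independent_mutate.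
Qed.

Lemma seed_quiver_foldl s ks :
  seed_quiver (foldl (@mutate_seed V) s ks) = foldl (@mutate_quiver V) (seed_quiver s) ks.
Proof. by elim: ks s => //= k ks IH s; rewrite IH. Qed.

End Seeds.

(** * The morphism attached to a fan *)

Section FanSequence.
Variables (V : finType) (r : nat) (g : 'I_r -> V).

(** The values 0, 1, x_1, ..., x_r, 1 on the chords {0, 0}, {0, 1}, ..., {0,
    r+2} of the fan at the vertex 0. *)
Definition fan_seq (R : comNzRingType) (x : V -> R) (j : nat) : R :=
  match j with
  | 0 => 0
  | 1 => 1
  | j'.+2 => oapp (x \o g) 1 (insub j')
  end.

Arguments fan_seq : simpl never.

Lemma fan_seq_ord (R : comNzRingType) (x : V -> R) (i : 'I_r) : fan_seq x i.+2 = x (g i).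
Proof. by rewrite /fan_seq insubT ?ltn_ord //= => lt_ir; congr (x (g _)); apply: val_inj. Qed.

Lemma fan_seq_last (R : comNzRingType) (x : V -> R) : fan_seq x r.+2 = 1.
Proof. by rewrite /fan_seq insubF ?ltnn. Qed.

Lemma cluster_eval_fan_seq (R : comNzRingType) (x : V -> R) j :
  cluster_eval x (fan_seq (fun v => 'X_(enum_rank v)) j) = fan_seq x j.
Proof.
rewrite /fan_seq; case: j => [|[|j]]; rewrite ?rmorph0 ?rmorph1 //.
by case: insubP => [i _ _|_]; rewrite ?rmorph1 //= cluster_evalX.
Qed.

(** The parameters t_j for which the values of the fan satisfy the
    recurrence of continuants. *)
Definition fan_params (K : fieldType) (x : V -> K) (j : nat) : K :=
  (fan_seq x j.+2 + fan_seq x j) / fan_seq x j.+1.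

Section Field.
Variables (K : fieldType) (x : V -> K).
Hypothesis xI : alg_independent x.

Lemma fan_seq_neq0 j : fan_seq x j.+1 != 0.
Proof.
case: j => [|j]; rewrite /fan_seq ?oner_eq0 //.
by case: insubP => [i _ _|_]; rewrite /= ?oner_eq0 //; apply: alg_independent_neq0.
Qed.

Lemma continuant_fan_params j : continuant (fan_params x) j = fan_seq x j.
Proof.
elim/nat_ind2: j => // j IH0 IH1.
by rewrite chainSS IH0 IH1 divfK ?fan_seq_neq0 // addrK.
Qed.

Local Notation T := (variable_seq r).
Local Notation P := (continuant T).

Definition fan_eval : {mpoly int[r.+1]} -> K := int_eval (fun i : 'I_r.+1 => fan_params x i).

HB.instance Definition _ := GRing.RMorphism.copy fan_eval
  (int_eval (fun i : 'I_r.+1 => fan_params x i)).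

Lemma fan_eval_relation : fan_eval (P r.+2 - 1) = 0.
Proof.
rewrite rmorphB rmorph1 /= /fan_eval int_eval_continuant // continuant_fan_params.
by rewrite fan_seq_last subrr.
Qed.

Lemma fan_eval_ker p :
  injective g -> fan_eval p = 0 -> exists q, p = q * (P r.+2 - 1).
Proof.
move=> g_inj; pose J (h : {mpoly int[r.+1]}) := exists q, h = q * (P r.+2 - 1).
have J0 : J 0 by exists 0; rewrite mul0r.
(* [z] sends the cluster to the continuants that [fan_eval] maps to it. *)
pose z (v : V) : {mpoly int[r.+1]} := oapp (fun i : 'I_r => P i.+2) 0 [pick i | g i == v].
have zP j : (j <= r.+1)%N -> fan_seq z j = P j.
  case: j => [|[|j]] // lt_jr; pose i : 'I_r := Ordinal (lt_jr : (j < r)%N).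
  rewrite (fan_seq_ord z i) /z.
  by case: pickP => [i' /eqP/g_inj ->|/(_ i)] //; rewrite eqxx.
apply: (clear_denominators (rho := idfun) (iota := cluster_eval x)
  (pi := cluster_eval z) (J := J)) => //=.
- by move=> _ _ [q ->] [q' ->]; exists (q - q'); rewrite mulrBl.
- by move=> h _ [q ->]; exists (h * q); rewrite mulrA.
- exact: alg_independent_inj.
move=> i; pose u := fan_seq (fun v => 'X_(enum_rank v) : {mpoly int[#|V|]}).
exists (u i.+1), (u i.+2 + u i); rewrite !rmorphD /= !cluster_eval_fan_seq.
have lt_ir := ltn_ord i; rewrite zP // [fan_seq z i]zP; last exact: ltnW.
split=> [h||]; first by apply: continuant_cancel; rewrite -ltnS.
  by rewrite /fan_eval int_evalX mulrC divfK ?fan_seq_neq0.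
have -> : P i.+1 * 'X_i - (fan_seq z i.+2 + P i) = P i.+2 - fan_seq z i.+2.
  by rewrite chainSS variable_seqE; ring.
have [lt_i|eq_i] : (i < r)%N \/ i = r :> nat by lia.
  by rewrite zP // subrr.
by rewrite eq_i fan_seq_last; exists 1; rewrite mul1r.
Qed.

End Field.
End FanSequence.

(** * Orientations of a path *)

Section PathOrientations.
Local Open Scope nat_scope.
Variables (V : finType) (r : nat) (f : V -> 'I_r).
Hypothesis f_bij : bijective f.
Implicit Types (Q : quiver V) (e : nat -> bool).

(** e c is true when the edge between the vertices numbered c and c+1 points
    upwards. *)
Definition path_quiver e Q := forall i j,
  Q i j = ((f i).+1 == f j) && e (f i) || ((f j).+1 == f i) && ~~ e (f j) :> nat.

(** No path goes through a source k, so the mutation at k only reverses the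
    two edges at k. *)
Lemma mutate_source e Q k : path_quiver e Q ->
  e (f k) -> (forall c, c.+1 = f k -> ~~ e c) ->
  path_quiver (fun c => if c == f k then false else (c.+1 == f k) || e c) (mutate_quiver Q k).
Proof.
move=> Qe ek eNk.
have Qk i : Q i k = 0%N.
  rewrite Qe ek andbF orbF; case: eqP => //= /eNk/negPf -> //.
have eqf i j : (f i == f j :> nat) = (i == j).
  by rewrite (inj_eq val_inj) (inj_eq (bij_inj f_bij)).
move=> i j /=; rewrite /mutate_arrows /arrows_with_paths !eqf !Qk !mul0n !addn0.
have [->|ik] := eqVneq i k; rewrite /=.
  rewrite Qk andbF /=; case: (eqVneq j k) => [->|jk]; first by rewrite (gtn_eqF (ltnSn _)).
  by case: ((f j).+1 == f k).
have [->|jk] := eqVneq j k; rewrite /=.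
  rewrite Qe ek; case: (@eqP _ (f i).+1) => [E|_]; rewrite ?(eNk _ E) ?andbT ?andbF ?orbF //=.
  by rewrite orbC.
have -> : Q i j - Q j i = Q i j.
  by case/orP: (quiver_no_2cycle Q i j) => /eqP ->; rewrite ?sub0n ?subn0.
rewrite Qe; congr (nat_of_bool (_ || _)).
  by case: eqP => //= ->; rewrite eqf (negPf jk).
by case: eqP => //= ->; rewrite eqf (negPf ik).
Qed.

(** An upward edge at p can be pushed down to the end of the path and then
    off it: if all the lower edges point downwards, the vertex numbered p is
    a source, and mutating there makes the edge p point downwards and the
    edge p-1 point upwards. *)
Lemma flip_edge p : (p < r)%N -> forall e Q, path_quiver e Q ->
  (forall c, (c < p)%N -> ~~ e c) -> e p ->
  exists ks e', path_quiver e' (foldl (@mutate_quiver V) Q ks) /\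
    forall c, (c <= p)%N -> ~~ e' c.
Proof.
(* The induction on p also needs that the edges above p are left alone. *)
suff flip : (p < r)%N -> forall e Q, path_quiver e Q ->
  (forall c, (c < p)%N -> ~~ e c) -> e p ->
  exists ks e', [/\ path_quiver e' (foldl (@mutate_quiver V) Q ks),
    forall c, (c <= p)%N -> ~~ e' c & forall c, (p < c)%N -> e' c = e c].
  by move=> lt_pr e Q Qe eN ep; have [ks [e' []]] := flip lt_pr e Q Qe eN ep; exists ks, e'.
have [g _ gK] := f_bij.
elim: p => [|p IH] lt_pr e Q Qe eN ep.
  pose k := g (Ordinal lt_pr); have fk : f k = 0%N :> nat by rewrite gK.
  have ek : e (f k) by rewrite fk.
  have eNk c : c.+1 = f k -> ~~ e c by rewrite fk.
  have Q1 := mutate_source Qe ek eNk.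
  exists [:: k]; eexists; split; first exact: Q1.
    by move=> c; rewrite leqn0 fk => ->.
  by case=> // c _; rewrite fk.
pose k := g (Ordinal lt_pr); have fk : f k = p.+1 :> nat by rewrite gK.
have ek : e (f k) by rewrite fk.
have eNk c : c.+1 = f k -> ~~ e c by rewrite fk => -[->]; apply: eN.
have Q1 := mutate_source Qe ek eNk.
have [|||ks [e' [Qe' e'N e'E]]] := IH _ _ _ Q1.
- exact: ltnW.
- move=> c lt_cp; rewrite fk eqSS !ltn_eqF //; last exact: ltnW.
  by apply: eN; exact: ltnW.
- by rewrite fk eqxx ltn_eqF.
exists (k :: ks), e'; split=> // c.
  rewrite leq_eqVlt => /orP[/eqP ->|]; last exact: e'N.
  by rewrite e'E // fk eqxx.
by move=> lt_pc; rewrite e'E ?fk ?(gtn_eqF lt_pc) ?gtn_eqF //; lia.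
Qed.

Lemma linear_orientation Q :
  (forall i j, Q i j + Q j i = ((f i).+1 == f j :> nat) || ((f j).+1 == f i :> nat)) ->
  exists ks, forall i j, foldl (@mutate_quiver V) Q ks i j = ((f j).+1 == f i :> nat).
Proof.
move=> Qpath.
pose e c := [exists i, exists j, [&& f i == c :> nat, f j == c.+1 :> nat & Q i j != 0]].
have eqf i j : f i = f j :> nat -> i = j by move=> /val_inj/(bij_inj f_bij).
have Qe : path_quiver e Q.
  have eE i j : (f i).+1 = f j -> e (f i) = (Q i j != 0).
    move=> fij; apply/existsP/idP => [[i' /existsP[j' /and3P[/eqP/eqf -> /eqP]]]|Qij].
      by rewrite fij => /eqf ->.
    by exists i; apply/existsP; exists j; rewrite fij !eqxx.
  move=> i j; have := Qpath i j; have := quiver_no_2cycle Q i j.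
  case: ((f i).+1 =P f j) => [fij|_]; case: ((f j).+1 =P f i) => [fji|_] /=; rewrite ?orbF.
  - lia.
  - by rewrite (eE _ _ fij); case: (Q i j) => [|[|m]] //=; lia.
  - by rewrite (eE _ _ fji); case: (Q j i) => [|[|m]] //=; lia.
  - lia.
have [ks [e' [Qe' e'N]]] : exists ks e', path_quiver e' (foldl (@mutate_quiver V) Q ks) /\
    forall c, (c < r)%N -> ~~ e' c.
  suff {Qpath} flip p : (p <= r)%N -> exists ks e',
      path_quiver e' (foldl (@mutate_quiver V) Q ks) /\ forall c, (c < p)%N -> ~~ e' c.
    exact: flip.
  elim: p => [|p IH] lt_pr; first by exists [::], e.
  have [ks [e' [Qe' e'N]]] := IH (ltnW lt_pr).
  have [e'p|e'p] := boolP (e' p).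
    have [ks' [e'' [Qe'' e''N]]] := flip_edge lt_pr Qe' e'N e'p.
    by exists (ks ++ ks'), e''; rewrite foldl_cat.
  exists ks, e'; split=> // c; rewrite ltnS leq_eqVlt => /orP[/eqP -> //|]; exact: e'N.
by exists ks => i j; rewrite Qe' (negPf (e'N _ (ltn_ord _))) (e'N _ (ltn_ord _)) andbF andbT.
Qed.

End PathOrientations.

(** * Triangulations and flips *)

(** The vertices x, y, z of the polygon are met in this order when going
    round. *)
Definition cyclic (x y z : nat) : bool :=
  [|| x < y < z, y < z < x | z < x < y]%N.

Definition joins (e : nat * nat) (x y : nat) : bool := (e == (x, y)) || (e == (y, x)).

Lemma joinsC e x y : joins e x y = joins e y x.
Proof. by rewrite /joins orbC. Qed.

Lemma joins_endpoints e : joins e e.1 e.2.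
Proof. by rewrite /joins -surjective_pairing eqxx. Qed.

Lemma joinsE e x y u v : joins e x y -> joins e u v = ((u, v) == (x, y)) || ((u, v) == (y, x)).
Proof. by case/orP => /eqP ->; rewrite /joins !xpair_eqE; lia. Qed.

Lemma joins_notin e x y u v : joins e x y -> u != x -> u != y -> joins e u v = false.
Proof. by move=> /joinsE-> /negPf ux /negPf uy; rewrite !xpair_eqE ux uy. Qed.

Lemma cyclic_distinct p q c d : cyclic q p c -> cyclic p q d ->
  [/\ p != q, p != c, p != d, q != c & q != d /\ c != d].
Proof. by rewrite /cyclic => qpc pqd; do !split; lia. Qed.

Lemma joins_sum i j u v : i != j ->
  joins (i, j) u v = (((i, j) == (u, v)) + ((j, i) == (u, v)))%N :> nat.
Proof.
move=> ij; rewrite /joins ![_ == (_, _)]xpair_eqE [(i == v) && _]andbC.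
by case: (eqVneq i u) => [<-|_] //; rewrite [j == i]eq_sym (negPf ij) orbF addn0.
Qed.

(** The determinant of the vectors of coordinates (a i, b i) and (a j, b j),
    with the sign that makes it symmetric in i and j. *)
Definition chord (R : comNzRingType) (a b : nat -> R) i j : R :=
  if (i < j)%N then a i * b j - a j * b i else a j * b i - a i * b j.

Lemma rmorph_chord (R S : comNzRingType) (f : {rmorphism R -> S}) t i j :
  f (chord (cocontinuant t) (continuant t) i j) =
  chord (cocontinuant (f \o t)) (continuant (f \o t)) i j.
Proof.
rewrite /chord; case: ifP => _;
by rewrite rmorphB !rmorphM !(rmorph_chain f) rmorph0 rmorph1.
Qed.

Section Chords.
Variables (K : fieldType) (a b : nat -> K).

Local Notation chord := (chord a b).

Lemma chordC i j : chord i j = chord j i.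
Proof. by rewrite /chord; case: (ltngtP i j) => // ->. Qed.

(** The Ptolemy relation in the quadrilateral p, c, q, d; the cyclic orders
    are what makes all the signs positive. *)
Lemma ptolemy p q c d : cyclic q p c -> cyclic p q d ->
  chord p q * chord c d = chord c q * chord d p + chord p c * chord q d.
Proof.
rewrite /cyclic /chord => qpc pqd.
do ![case: ifP => ?]; try lia; ring.
Qed.

Variable V : finType.
Implicit Types (x : V -> K) (v w k : V) (lab : V -> nat * nat) (apex : nat -> nat -> nat).

Definition side lab apex i j z :=
  chord i j = 1 \/ exists2 w, joins (lab w) i j & apex i j = z.

(** The diagonals are labelled by the vertices of the quiver, [apex i j] is
    the apex of the triangle lying on the side of the oriented diagonal from
    i to j prescribed by the cyclic order, and [side] says that an edge of
    such a triangle is either a side of the polygon, recognized by its value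
    1, or a diagonal with the opposite vertex as apex. The algebraic
    independence of the values plays the part of planarity: it is what shows
    that a flip creates a new diagonal. *)
Record triangulation x lab apex := Triangulation {
  triangulation_label : forall v, x v = chord (lab v).1 (lab v).2;
  triangulation_cyclic : forall v i j, joins (lab v) i j -> cyclic i j (apex i j);
  triangulation_next : forall v i j, joins (lab v) i j -> side lab apex j (apex i j) i;
  triangulation_prev : forall v i j, joins (lab v) i j -> side lab apex (apex i j) i j
}.

(** In each triangle the arrows go from an edge to the next one. *)
Definition triangle_arrows lab apex v w : nat :=
  (joins (lab w) (lab v).2 (apex (lab v).1 (lab v).2)
   + joins (lab w) (lab v).1 (apex (lab v).2 (lab v).1))%N.

Section Triangulation.
Variables (x : V -> K) (lab : V -> nat * nat) (apex : nat -> nat -> nat).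
Hypotheses (T : triangulation x lab apex) (x_inj : injective x) (x_neq1 : forall v, x v != 1).

Lemma joins_chord v i j : joins (lab v) i j -> x v = chord i j.
Proof.
by rewrite (triangulation_label T) => /orP[] /eqP -> //; rewrite chordC.
Qed.

(** Diagonals with the same endpoints carry the same value, and the values
    are distinct. *)
Lemma joins_inj v w i j : joins (lab v) i j -> joins (lab w) i j -> v = w.
Proof. by move=> /joins_chord vE /joins_chord wE; apply: x_inj; rewrite vE wE. Qed.

Lemma side_labelled w i j z : side lab apex i j z -> joins (lab w) i j -> apex i j = z.
Proof. by case=> [ij1|[]//] /joins_chord wE; case/eqP: (x_neq1 w); rewrite wE. Qed.

Lemma next_labelled v w i j :
  joins (lab v) i j -> joins (lab w) j (apex i j) -> apex j (apex i j) = i.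
Proof. by move=> /(triangulation_next T)/side_labelled; apply. Qed.

Lemma prev_labelled v w i j :
  joins (lab v) i j -> joins (lab w) (apex i j) i -> apex (apex i j) i = j.
Proof. by move=> /(triangulation_prev T)/side_labelled; apply. Qed.

Lemma dart_neq v i j : joins (lab v) i j -> i != j.
Proof. by move=> /(triangulation_cyclic T); rewrite /cyclic; lia. Qed.

Lemma triangle_arrows_from k p q w : joins (lab k) p q ->
  triangle_arrows lab apex k w = (joins (lab w) q (apex p q) + joins (lab w) p (apex q p))%N.
Proof. by case/orP => /eqP kE; rewrite /triangle_arrows kE //= addnC. Qed.

(** The edges that precede the diagonal {p, q} in its two triangles. *)
Lemma triangle_arrows_to k p q v : joins (lab k) p q ->
  triangle_arrows lab apex v k =
  (joins (lab v) (apex q p) q + joins (lab v) (apex p q) p)%N.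
Proof.
move=> kpq; have kqp : joins (lab k) q p by rewrite joinsC.
have pq := dart_neq kpq.
have dart i j : joins (lab v) i j ->
    joins (lab k) j (apex i j) = (((i, j) == (apex q p, q)) + ((i, j) == (apex p q, p)) :> nat)%N
      :> nat.
  move=> vij; rewrite !xpair_eqE.
  have [jp|jp] := eqVneq j p.
    rewrite {}jp in vij *; rewrite (negPf pq) andbF andbT add0n; congr nat_of_bool.
    apply/idP/eqP => [kp|iE]; last first.
      by move: vij; rewrite iE => /(prev_labelled kpq) ->.
    have aiq : apex i p = q.
      by move: kp; rewrite (joinsE _ _ kpq) !xpair_eqE eqxx (negPf pq) orbF => /eqP.
    by rewrite -(next_labelled vij kp) aiq.
  rewrite andbF addn0; congr nat_of_bool; apply/idP/andP => [kj|[/eqP ic /eqP jq]].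
    have /andP[/eqP jq /eqP aip] : (j == q) && (apex i j == p).
      by move: kj; rewrite (joinsE _ _ kpq) !xpair_eqE (negPf jp).
    by rewrite -(next_labelled vij kj) aip jq !eqxx.
  by move: vij; rewrite ic jq => /(prev_labelled kqp) ->.
rewrite /triangle_arrows !dart ?joins_endpoints //; last by rewrite joinsC joins_endpoints.
have := dart_neq (joins_endpoints (lab v)).
by case: (lab v) => i j /= ij; rewrite !joins_sum // addnACA.
Qed.

Lemma triangle_arrows_no_2cycle v k :
  triangle_arrows lab apex v k = 0%N \/ triangle_arrows lab apex k v = 0%N.
Proof.
have kpq := joins_endpoints (lab k).
rewrite (triangle_arrows_from _ kpq) (triangle_arrows_to _ kpq).
move: (lab k).1 (lab k).2 kpq => p q kpq; have kqp : joins (lab k) q p by rewrite joinsC.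
have := triangulation_cyclic T kpq; have := triangulation_cyclic T kqp.
move: (apex q p) (apex p q) => c d qpc pqd.
have [pq pc pd qc [qd cd]] := cyclic_distinct qpc pqd.
have [J|_] := boolP (joins (lab v) c q).
  by right; rewrite joinsC !(joins_notin _ J) // eq_sym.
have [J|_] := boolP (joins (lab v) d p); last by left.
by right; rewrite [joins _ p c]joinsC !(joins_notin _ J) // eq_sym.
Qed.

End Triangulation.

Definition flip_label lab k c d v := if v == k then (c, d) else lab v.

(** The triangles (q, p, c) and (p, q, d) are replaced by (c, q, d) and (d,
    p, c), which have six oriented edges in all. *)
Definition flip_apex apex p q c d i j : nat :=
  if (i, j) == (c, q) then d else if (i, j) == (q, d) then c
  else if (i, j) == (d, c) then q else if (i, j) == (d, p) then c
  else if (i, j) == (p, c) then d else if (i, j) == (c, d) then p else apex i j.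

Section Flip.
Variables (x : V -> K) (lab : V -> nat * nat) (apex : nat -> nat -> nat).
Hypotheses (T : triangulation x lab apex) (x_inj : injective x) (x_neq1 : forall v, x v != 1).
Variables (k : V) (p q c d : nat).
Hypotheses (kpq : joins (lab k) p q) (apqp : apex q p = c) (appq : apex p q = d).

Local Notation x' := (fun v => if v == k then chord c d else x v).
Local Notation lab' := (flip_label lab k c d).
Local Notation apex' := (flip_apex apex p q c d).

Hypothesis x'_inj : injective x'.

Let kqp : joins (lab k) q p. Proof. by rewrite joinsC. Qed.
Let qpc : cyclic q p c. Proof. by have := triangulation_cyclic T kqp; rewrite apqp. Qed.
Let pqd : cyclic p q d. Proof. by have := triangulation_cyclic T kpq; rewrite appq. Qed.

Let neqs : [/\ (p == q) = false, (p == c) = false, (p == d) = false, (q == c) = false &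
  (q == d) = false /\ (c == d) = false].
Proof. by have [? ? ? ? [? ?]] := cyclic_distinct qpc pqd; split; try split; apply: negbTE. Qed.

Let neqs_sym : [/\ (q == p) = false, (c == p) = false, (d == p) = false, (c == q) = false &
  (d == q) = false /\ (d == c) = false].
Proof. by have [? ? ? ? [? ?]] := neqs; split; try split; rewrite eq_sym. Qed.

Let sides : seq (nat * nat) := [:: (c, q); (q, d); (d, p); (p, c)].

Lemma flip_apex_new :
  [/\ apex' c q = d, apex' q d = c, apex' d p = c, apex' p c = d & apex' c d = p /\ apex' d c = q].
Proof.
have [n1 n2 n3 n4 [n5 n6]] := neqs; have [m1 m2 m3 m4 [m5 m6]] := neqs_sym.
rewrite /flip_apex !xpair_eqE !eqxx.
by rewrite ?(n1, n2, n3, n4, n5, n6, m1, m2, m3, m4, m5, m6) /=.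
Qed.

Lemma flip_apex_old i j : (i, j) \notin sides -> ~~ joins (c, d) i j -> apex' i j = apex i j.
Proof.
rewrite /joins !inE !negb_or => /and4P[/negPf n1 /negPf n2 /negPf n3 /negPf n4].
rewrite ![(c, d) == _]eq_sym => /andP[/negPf n5 n6].
rewrite /flip_apex n1 n2 n3 n4 n5.
by move: n6; rewrite !xpair_eqE andbC => /negPf ->.
Qed.

(** The new diagonal {c, d} is not an old one, since its value is new. *)
Lemma flip_labelled v i j : v != k -> joins (lab v) i j -> ~~ joins (c, d) i j.
Proof.
move=> vk vij; apply: contra vk => cij.
suff: x' v = x' k by move=> /x'_inj ->.
rewrite eqxx; case: eqP => // _; rewrite (joins_chord T vij).
by case/orP: cij => /eqP[-> ->] //; rewrite chordC.
Qed.

Lemma flip_labelled_neq v i j : v != k -> joins (lab v) i j -> ~~ joins (p, q) i j.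
Proof.
move=> vk vij; apply: contra vk => pij; apply/eqP.
by case/orP: pij vij => /eqP[<- <-] vij; apply: (joins_inj T x_inj vij).
Qed.

Lemma joins_pq i j : joins (lab k) i j = joins (p, q) i j.
Proof. by rewrite (joinsE _ _ kpq) /joins ![(p, q) == _]eq_sym !xpair_eqE [(i == q) && _]andbC. Qed.

(** An edge other than {p, q} that was a side remains one, opposite to a
    possibly different vertex. *)
Lemma side_flip i j z z' : ~~ joins (p, q) i j -> side lab apex i j z ->
  (forall w, w != k -> joins (lab w) i j -> apex' i j = z') -> side lab' apex' i j z'.
Proof.
move=> Npq [ij1|[w wij _]] apE; first by left.
have wk : w != k by apply: contraNneq Npq => wk; rewrite -joins_pq -wk.
by right; exists w; [rewrite /flip_label (negPf wk)|exact: apE wij].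
Qed.

Lemma quadrilateral_sides :
  [/\ side lab apex c q p, side lab apex q d p, side lab apex d p q & side lab apex p c q].
Proof.
have := triangulation_next T kpq; have := triangulation_prev T kpq.
have := triangulation_next T kqp; have := triangulation_prev T kqp.
by rewrite apqp appq.
Qed.

(** The edges of the quadrilateral have the far endpoint of {p, q} as apex,
    because the triangle on that side is one of the two that contain {p, q}. *)
Lemma quadrilateral_labelled w i j :
  joins (lab w) i j -> (i, j) \in sides -> apex i j = if (i, j) \in [:: (c, q); (q, d)] then p else q.
Proof.
have [n1 n2 n3 n4 [n5 n6]] := neqs; have [m1 m2 m3 m4 [m5 m6]] := neqs_sym.
have [s1 s2 s3 s4] := quadrilateral_sides.
move=> wij; rewrite !inE => /or4P[] /eqP ij; move: wij; case: ij => -> -> wij;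
  [rewrite (side_labelled T x_neq1 s1 wij)|rewrite (side_labelled T x_neq1 s2 wij)
  |rewrite (side_labelled T x_neq1 s3 wij)|rewrite (side_labelled T x_neq1 s4 wij)];
  by rewrite !xpair_eqE ?eqxx ?(n1, n2, n3, n4, n5, n6, m1, m2, m3, m4, m5, m6).
Qed.

(** An oriented diagonal outside the quadrilateral keeps its triangle. Were
    an edge of this triangle affected by the flip, its apex would be p, q, c
    or d, and the given diagonal would be {p, q} or an edge of the
    quadrilateral. *)
Lemma next_flip v i j : v != k -> joins (lab v) i j -> (i, j) \notin sides ->
  side lab' apex' j (apex i j) i.
Proof.
move=> vk vij Nij; have s_ij := triangulation_next T vij.
have Npq := flip_labelled_neq vk vij.
apply: side_flip (s_ij) _ => [|w wk w_ij].
  apply: contraNN Nij => pq_ij; have k_ij : joins (lab k) j (apex i j) by rewrite joins_pq.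
  have := side_labelled T x_neq1 s_ij k_ij.
  by case/orP: pq_ij => /eqP[<- <-]; rewrite ?appq ?apqp => <-; rewrite !inE eqxx ?orbT.
have ap_w := side_labelled T x_neq1 s_ij w_ij.
rewrite flip_apex_old ?(flip_labelled wk w_ij) //.
apply/negP => in_sides; have := quadrilateral_labelled w_ij in_sides; rewrite ap_w.
have [n1 n2 n3 n4 [n5 n6]] := neqs; have [m1 m2 m3 m4 [m5 m6]] := neqs_sym.
move: in_sides Nij Npq; rewrite !inE /joins.
by case/or4P=> /eqP[-> ->] N1 N2 iE; move: N1 N2; rewrite iE !xpair_eqE !eqxx;
   rewrite ?(n1, n2, n3, n4, n5, n6, m1, m2, m3, m4, m5, m6) ?eqxx.
Qed.

Lemma prev_flip v i j : v != k -> joins (lab v) i j -> (i, j) \notin sides ->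
  side lab' apex' (apex i j) i j.
Proof.
move=> vk vij Nij; have s_ij := triangulation_prev T vij.
have Npq := flip_labelled_neq vk vij.
apply: side_flip (s_ij) _ => [|w wk w_ij].
  apply: contraNN Nij => pq_ij; have k_ij : joins (lab k) (apex i j) i by rewrite joins_pq.
  have := side_labelled T x_neq1 s_ij k_ij.
  by case/orP: pq_ij => /eqP[<- <-]; rewrite ?appq ?apqp => <-; rewrite !inE eqxx ?orbT.
have ap_w := side_labelled T x_neq1 s_ij w_ij.
rewrite flip_apex_old ?(flip_labelled wk w_ij) //.
apply/negP => in_sides; have := quadrilateral_labelled w_ij in_sides; rewrite ap_w.
have [n1 n2 n3 n4 [n5 n6]] := neqs; have [m1 m2 m3 m4 [m5 m6]] := neqs_sym.
move: in_sides Nij Npq; rewrite !inE /joins.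
by case/or4P=> /eqP[zE iE]; rewrite zE iE => N1 N2 jE; move: N1 N2; rewrite jE !xpair_eqE !eqxx;
   rewrite ?(n1, n2, n3, n4, n5, n6, m1, m2, m3, m4, m5, m6) ?eqxx.
Qed.

Lemma flip_triangulation : triangulation x' lab' apex'.
Proof.
have [n1 n2 n3 n4 [n5 n6]] := neqs; have [m1 m2 m3 m4 [m5 m6]] := neqs_sym.
have [a_cq a_qd a_dp a_pc [a_cd a_dc]] := flip_apex_new.
have [s1 s2 s3 s4] := quadrilateral_sides.
have [s_cq s_qd s_dp s_pc] :
  [/\ side lab' apex' c q d, side lab' apex' q d c, side lab' apex' d p c & side lab' apex' p c d].
  split; [apply: side_flip s1 _|apply: side_flip s2 _|apply: side_flip s3 _|apply: side_flip s4 _] => //;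
  by rewrite /joins !xpair_eqE ?(n1, n2, n3, n4, n5, n6, m1, m2, m3, m4, m5, m6) ?andbF.
have [s_cd s_dc] : side lab' apex' c d p /\ side lab' apex' d c q.
  by split; right; exists k => //; rewrite /flip_label eqxx /joins eqxx ?orbT.
have new v i j : joins (lab' v) i j ->
    joins (c, d) i j \/ [/\ v != k, joins (lab v) i j & ~~ joins (c, d) i j].
  rewrite /flip_label; case: eqP => [_|/eqP vk] vij; [by left|right; split => //].
  exact: flip_labelled vij.
split.
- by move=> v; rewrite /flip_label; case: eqP => // _; apply: (triangulation_label T).
- move=> v i j /new[|[vk vij Ncd]].
    by case/orP=> /eqP[<- <-]; rewrite ?a_cd ?a_dc; move: qpc pqd; rewrite /cyclic; lia.
  have [|Nij] := boolP ((i, j) \in sides); last first.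
    by rewrite flip_apex_old //; apply: (triangulation_cyclic T vij).
  rewrite !inE; move: qpc pqd; rewrite /cyclic => ? ?.
  by case/or4P=> /eqP[-> ->]; rewrite ?a_cq ?a_qd ?a_dp ?a_pc; lia.
- move=> v i j /new[|[vk vij Ncd]]; first by case/orP=> /eqP[<- <-]; rewrite ?a_cd ?a_dc.
  have [|Nij] := boolP ((i, j) \in sides); last first.
    by rewrite flip_apex_old //; apply: next_flip vij Nij.
  by rewrite !inE; case/or4P=> /eqP[-> ->]; rewrite ?a_cq ?a_qd ?a_dp ?a_pc.
- move=> v i j /new[|[vk vij Ncd]]; first by case/orP=> /eqP[<- <-]; rewrite ?a_cd ?a_dc.
  have [|Nij] := boolP ((i, j) \in sides); last first.
    by rewrite flip_apex_old //; apply: prev_flip vij Nij.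
  by rewrite !inE; case/or4P=> /eqP[-> ->]; rewrite ?a_cq ?a_qd ?a_dp ?a_pc.
Qed.

Lemma flip_dart_arrow v w i j : v != k -> w != k -> joins (lab v) i j ->
  (joins (lab w) j (apex' i j)
   + ((i, j) == (p, c)) * joins (lab w) c q + ((i, j) == (q, d)) * joins (lab w) d p
   = joins (lab w) j (apex i j)
   + ((i, j) == (c, q)) * joins (lab w) q d + ((i, j) == (d, p)) * joins (lab w) p c)%N.
Proof.
have [n1 n2 n3 n4 [n5 n6]] := neqs; have [m1 m2 m3 m4 [m5 m6]] := neqs_sym.
have [a_cq a_qd a_dp a_pc _] := flip_apex_new.
move=> vk wk vij; have Ncd := flip_labelled vk vij.
have Jcd : joins (lab w) c d = false.
  by apply/negP => /(flip_labelled wk); rewrite /joins eqxx.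
have Jpq : joins (lab w) p q = false.
  by apply/negP => /(flip_labelled_neq wk); rewrite /joins eqxx.
have [in_sides|Nij] := boolP ((i, j) \in sides).
  have := quadrilateral_labelled vij in_sides; move: in_sides; rewrite !inE.
  case/or4P=> /eqP[-> ->] ->; rewrite ?a_cq ?a_qd ?a_dp ?a_pc !xpair_eqE !eqxx;
  rewrite ?(n1, n2, n3, n4, n5, n6, m1, m2, m3, m4, m5, m6) ?eqxx;
  by rewrite ?(joinsC _ q p) ?(joinsC _ d c) ?Jpq ?Jcd !(mul0n, mul1n, addn0).
rewrite flip_apex_old //; move: Nij; rewrite !inE !negb_or.
by case/and4P => /negPf -> /negPf -> /negPf -> /negPf ->.
Qed.

(** The flip removes the arrows pc -> cq and qd -> dp inside the two old
    triangles and creates cq -> qd and dp -> pc inside the two new ones. The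
    identity is additive so as to avoid truncated subtraction. *)
Lemma flip_arrows v w : v != k -> w != k ->
  (triangle_arrows lab' apex' v w
   + joins (lab v) p c * joins (lab w) c q + joins (lab v) q d * joins (lab w) d p
   = triangle_arrows lab apex v w
   + joins (lab v) c q * joins (lab w) q d + joins (lab v) d p * joins (lab w) p c)%N.
Proof.
move=> vk wk; rewrite /triangle_arrows /flip_label (negPf vk) (negPf wk).
have vij := joins_endpoints (lab v).
have := flip_dart_arrow vk wk vij; have := flip_dart_arrow vk wk (etrans (joinsC _ _ _) vij).
have := dart_neq T vij; case: (lab v) => i j /= ij E1 E2.
rewrite !(joins_sum _ _ ij) !mulnDl; move: E1 E2; repeat move: (nat_of_bool _) => ?; lia.
Qed.

Hypothesis x'_neq1 : forall v, x' v != 1.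

(** Quiver mutation at {p, q}. Of the four paths through {p, q}, two are the
    new arrows of [flip_arrows] and two cancel the arrows that the flip
    removes. *)
Lemma flip_quiver v w : triangle_arrows lab' apex' v w =
  if (v == k) || (w == k) then triangle_arrows lab apex w v
  else ((triangle_arrows lab apex v w + triangle_arrows lab apex v k * triangle_arrows lab apex k w)
      - (triangle_arrows lab apex w v + triangle_arrows lab apex w k * triangle_arrows lab apex k v))%N.
Proof.
have T' := flip_triangulation.
have kcd : joins (lab' k) c d by rewrite /flip_label eqxx /joins eqxx.
have [_ _ _ _ [a_cd a_dc]] := flip_apex_new.
have [->|vk] := eqVneq v k.
  have [->|wk] := eqVneq w k.
    have [] := triangle_arrows_no_2cycle T x_neq1 k k => ->;
    by have [] := triangle_arrows_no_2cycle T' x'_neq1 k k => ->.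
  rewrite (triangle_arrows_from _ _ kcd) (triangle_arrows_to T x_neq1 _ kpq) a_cd a_dc apqp appq.
  by rewrite /flip_label (negPf wk) addnC [joins _ c q]joinsC.
have [->|wk] := eqVneq w k; rewrite /=.
  rewrite (triangle_arrows_to T' x'_neq1 _ kcd) (triangle_arrows_from _ _ kpq) a_cd a_dc apqp appq.
  by rewrite /flip_label (negPf vk).
have := flip_arrows vk wk; have := flip_arrows wk vk.
rewrite !(triangle_arrows_from _ _ kpq) !(triangle_arrows_to T x_neq1 _ kpq) apqp appq.
have := triangle_arrows_no_2cycle T' x'_neq1 v w.
rewrite !mulnDl !mulnDr.
move: (triangle_arrows lab' apex' v w) (triangle_arrows lab' apex' w v) => A' B'.
move: (triangle_arrows lab apex v w) (triangle_arrows lab apex w v) => A B.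
repeat move: (nat_of_bool _) => ?; lia.
Qed.

End Flip.
End Chords.

(** * Seeds given by triangulations *)

Section TriangulatedSeeds.
Variables (V : finType) (a b : nat -> ambient_field V).
Implicit Types (s : seed V) (k : V).

Definition triangulated s := exists lab apex,
  triangulation a b (seed_cluster s) lab apex /\
  forall v w, seed_quiver s v w = triangle_arrows lab apex v w.

(** A side of a triangle contributes its value to an exchange relation
    whether it is a diagonal or a side of the polygon. *)
Lemma prod_joins (x : V -> ambient_field V) lab apex i j z :
  triangulation a b x lab apex -> injective x ->
  side a b lab apex i j z -> \prod_v x v ^+ joins (lab v) i j = chord a b i j.
Proof.
move=> T x_inj sij; have [/existsP[v vij]|/existsPn none] := boolP [exists v, joins (lab v) i j].
  rewrite (bigD1 v) //= vij (joins_chord T vij) big1 ?mulr1 // => w wv.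
  have [wij|_] := boolP (joins (lab w) i j); last by rewrite expr0.
  by rewrite (joins_inj T x_inj wij vij) eqxx in wv.
rewrite big1 => [|v _]; last by rewrite (negPf (none v)).
by case: sij => [->|[v vij]] //; rewrite (negPf (none v)) in vij.
Qed.

(** The exchange relation is the Ptolemy relation of the quadrilateral
    around the diagonal. *)
Lemma exchange_chord s k lab apex :
  alg_independent (seed_cluster s) -> triangulation a b (seed_cluster s) lab apex ->
  (forall v w, seed_quiver s v w = triangle_arrows lab apex v w) ->
  exchange_variable s k =
  chord a b (apex (lab k).2 (lab k).1) (apex (lab k).1 (lab k).2).
Proof.
move=> sI T arrE; have x_inj := alg_independent_injective sI.
have x_neq1 v := alg_independent_neq1 v sI.
have kpq := joins_endpoints (lab k).
set p := (lab k).1 in kpq *; set q := (lab k).2 in kpq *.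
have kqp : joins (lab k) q p by rewrite joinsC.
have [s1 s2 s3 s4] := quadrilateral_sides T kpq erefl erefl.
rewrite /exchange_variable.
under eq_bigr do rewrite arrE (triangle_arrows_to T x_neq1 _ kpq) exprD.
under [X in _ + X]eq_bigr do rewrite arrE (triangle_arrows_from _ _ kpq) exprD.
rewrite !big_split /= (prod_joins T x_inj s1) (prod_joins T x_inj s2).
rewrite (prod_joins T x_inj s3) (prod_joins T x_inj s4).
have xk_neq0 := alg_independent_neq0 k sI.
apply: (mulfI xk_neq0); rewrite [LHS]mulrC divfK // (joins_chord T kpq).
by rewrite (ptolemy _ _ (triangulation_cyclic T kqp) (triangulation_cyclic T kpq)); ring.
Qed.

Lemma triangulated_mutate s k :
  alg_independent (seed_cluster s) -> triangulated s -> triangulated (mutate_seed s k).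
Proof.
move=> sI [lab [apex [T arrE]]].
have := alg_independent_mutate (k := k) sI; rewrite [seed_cluster (mutate_seed s k)]/=.
rewrite (exchange_chord k sI T arrE) => x'I.
have x'_inj := alg_independent_injective x'I.
have x'_neq1 v := alg_independent_neq1 v x'I.
have x_inj := alg_independent_injective sI.
have x_neq1 v := alg_independent_neq1 v sI.
have kpq := joins_endpoints (lab k).
have T' := flip_triangulation T x_inj x_neq1 kpq erefl erefl x'_inj.
do 2!eexists; split.
  by rewrite [seed_cluster (mutate_seed s k)]/= (exchange_chord k sI T arrE); exact: T'.
move=> v w; rewrite (flip_quiver T x_inj x_neq1 kpq erefl erefl x'_inj x'_neq1).
by rewrite /= /mutate_arrows /arrows_with_paths !arrE.
Qed.

Lemma triangulated_foldl s ks : alg_independent (seed_cluster s) ->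
  triangulated s -> triangulated (foldl (@mutate_seed V) s ks).
Proof.
elim: ks s => [|k ks IH] s sI sT; first exact: sT.
by apply: IH; [apply: alg_independent_mutate|apply: triangulated_mutate].
Qed.

End TriangulatedSeeds.

(** * The seed of the linear orientation *)

Section FanSeed.
Variables (V : finType) (r : nat) (f : V -> 'I_r) (g : 'I_r -> V).
Hypotheses (fK : cancel f g) (gK : cancel g f).
Variable s : seed V.
Hypothesis sI : alg_independent (seed_cluster s).
Hypothesis s_linear : forall v w, seed_quiver s v w = ((f w).+1 == f v :> nat).

Local Notation x := (seed_cluster s).
Local Notation ev := (fan_eval (r := r) g x).
Local Notation t := (ev \o variable_seq r).

Lemma fan_seq_vertex v : fan_seq g x (f v).+2 = x v.
Proof. by rewrite fan_seq_ord fK. Qed.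

Lemma continuant_fan j : (j <= r.+2)%N -> continuant t j = fan_seq g x j.
Proof.
move=> le_jr; rewrite -(rmorph_continuant (fan_eval (r := r) g x)) /= /fan_eval.
by rewrite int_eval_continuant // continuant_fan_params.
Qed.

(** The diagonals {0, 2}, ..., {0, r+1}, with the triangles (0, j, j+1). *)
Lemma fan_triangulated : triangulated (cocontinuant t) (continuant t) s.
Proof.
have chord0 j : (0 < j <= r.+2)%N ->
    chord (cocontinuant t) (continuant t) 0 j = fan_seq g x j.
  move=> /andP[j_gt0 le_jr]; rewrite /chord j_gt0 continuant_fan //.
  by rewrite /chain mulr0 subr0 mul1r.
have chordS j : chord (cocontinuant t) (continuant t) j j.+1 = 1.
  by rewrite /chord ltnSn chain_det.
exists (fun v => (0%N, (f v).+2)), (fun i j => if i == 0%N then j.+1 else i.-1).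
split; last by move=> v w; rewrite s_linear /triangle_arrows /joins !xpair_eqE /=; lia.
have fan_side m : (0 < m <= r.+2)%N ->
    chord (cocontinuant t) (continuant t) 0 m = 1 \/ exists v, (f v).+2 = m.
  move=> le_m; rewrite chord0 //; case: m le_m => [|[|m]] // le_m; first by left.
  have [lt_mr|->] : (m < r)%N \/ m = r by lia.
    by right; exists (g (Ordinal lt_mr)); rewrite gK.
  by left; rewrite fan_seq_last.
have lt_f v : ((f v).+3 <= r.+2)%N by have := ltn_ord (f v); lia.
split=> [v|v i j|v i j|v i j].
- by rewrite chord0 ?fan_seq_vertex //=; apply: ltnW (lt_f v).
- by case/orP => /eqP[<- <-]; rewrite /cyclic /=; lia.
- case/orP => /eqP[<- <-]; first by left; rewrite chordS.
  have [|one|[w fw]] := fan_side (f v).+1; first by have := lt_f v; lia.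
    by left.
  by right; exists w => //=; rewrite /joins fw eqxx.
- case/orP => /eqP[<- <-]; last by left; rewrite chordS.
  have [|one|[w fw]] := fan_side (f v).+3; first by have := lt_f v; lia.
    by left; rewrite chordC.
  by right; exists w => //=; rewrite /joins fw eqxx orbT.
Qed.

Lemma prod_fan j : (0 < j)%N -> \prod_v x v ^+ ((f v).+2 == j) = fan_seq g x j.
Proof.
case: j => [|[|j]] // _; first by rewrite big1.
rewrite /fan_seq; case: insubP => [i _ ij|le_rj] /=.
  rewrite (bigD1 (g i)) //= gK ij eqxx expr1 big1 ?mulr1 // => v vi.
  by rewrite !eqSS -ij (inj_eq val_inj) -(inj_eq (can_inj gK)) fK (negPf vi).
by rewrite big1 // => v _; rewrite !eqSS ltn_eqF //; have := ltn_ord (f v); lia.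
Qed.

(** In the linear orientation the neighbours of the j-th variable are those
    of index j-1 and j+1, the values of the sides of the polygon replacing
    the missing ones. *)
Lemma exchange_fan v : exchange_variable s v = fan_params g x (f v).+1.
Proof.
rewrite /exchange_variable /fan_params fan_seq_vertex; congr ((_ + _) / _).
  by rewrite -prod_fan //; apply: eq_bigr => w _; rewrite s_linear !eqSS eq_sym.
by rewrite -prod_fan //; apply: eq_bigr => w _; rewrite s_linear !eqSS.
Qed.

End FanSeed.

(** * From image and kernel to the isomorphism *)

Section Isomorphism.
Variables (V : finType) (Q : quiver V) (r : nat).
Variable psi : {rmorphism {mpoly int[r.+1]} -> ambient_field V}.
Hypothesis psi_ker : forall p, psi p = 0 <-> exists q, p = q * (chebyshev r.+1 - 1).
Hypothesis psi_img : forall y, generated_subring (is_cluster_variable Q) y <-> exists p, psi p = y.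

Local Notation quot := (chebyshev_quotient r).

Lemma pi_eq p q : (\pi_quot p = \pi_quot q)%qT <-> psi p = psi q.
Proof.
have -> : (\pi_quot p = \pi_quot q)%qT <-> (p - q) \in @chebyshev_ideal r.
  rewrite (@Quotient.idealrBE _ (@chebyshev_ideal r : idealr _)).
  by split => [->//|/eqP].
rewrite inE; split=> [/asboolP/psi_ker|pq].
  by rewrite rmorphB => /eqP; rewrite subr_eq0 => /eqP.
by apply/asboolP/psi_ker; rewrite rmorphB pq subrr.
Qed.

Lemma polynomial_of_subproof (y : cluster_algebra Q) : exists p, psi p = val y.
Proof. by apply/psi_img; have := valP y; rewrite inE => /asboolP. Qed.

(** A preimage is chosen; by [pi_eq] its class does not depend on the
    choice. *)
Definition polynomial_of y : {mpoly int[r.+1]} := sval (cid (polynomial_of_subproof y)).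

Lemma psi_polynomial_of y : psi (polynomial_of y) = val y.
Proof. by rewrite /polynomial_of; case: cid. Qed.

Definition to_quotient (y : cluster_algebra Q) : quot := (\pi_quot (polynomial_of y))%qT.

Lemma to_quotient_zmod_morphism : zmod_morphism to_quotient.
Proof.
move=> y z; rewrite /to_quotient -rmorphB; apply/pi_eq.
by rewrite rmorphB !psi_polynomial_of.
Qed.

Lemma to_quotient_monoid_morphism : monoid_morphism to_quotient.
Proof.
split=> [|y z]; rewrite /to_quotient; first rewrite -[RHS](rmorph1 \pi_quot%qT).
  by apply/pi_eq; rewrite psi_polynomial_of !rmorph1.
by rewrite -rmorphM; apply/pi_eq; rewrite rmorphM !psi_polynomial_of.
Qed.

HB.instance Definition _ := GRing.isZmodMorphism.Build (cluster_algebra Q) quot to_quotient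
  to_quotient_zmod_morphism.
HB.instance Definition _ := GRing.isMonoidMorphism.Build (cluster_algebra Q) quot to_quotient
  to_quotient_monoid_morphism.

Lemma psi_repr_in (b : quot) : psi (repr b) \in in_cluster_algebra Q.
Proof. by rewrite inE; apply/asboolP/psi_img; exists (repr b). Qed.

Lemma to_quotient_bijective : bijective to_quotient.
Proof.
exists (fun b => ClusterAlgebra (psi_repr_in b)) => [y|b].
  by apply: val_inj => /=; rewrite -psi_polynomial_of; apply/pi_eq; rewrite reprK.
rewrite /to_quotient -[RHS](reprK b); apply/pi_eq.
by rewrite psi_polynomial_of.
Qed.

Lemma cluster_quotient_iso :
  exists f : {rmorphism cluster_algebra Q -> quot}, bijective f.
Proof. by exists to_quotient; apply: to_quotient_bijective. Qed.

End Isomorphism.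

(** * Image and kernel *)

(** Mutations of seeds can be undone, so the cluster variables may be
    computed from any reachable seed. *)
Lemma cluster_variable_mutation (V : finType) (Q : quiver V) ks (x : ambient_field V) :
  let s := foldl (@mutate_seed V) (initial_seed Q) ks in
  is_cluster_variable Q x -> exists ks' w, x = seed_cluster (foldl (@mutate_seed V) s ks') w.
Proof.
move=> s [ks' [w ->]]; exists (rev ks ++ ks'), w.
by rewrite foldl_cat foldl_mutate_seedK //; apply: alg_independent_initial.
Qed.

Lemma generated_subring_image n (K : comNzRingType)
    (psi : {rmorphism {mpoly int[n]} -> K}) (S : K -> Prop) :
  (forall i, S (psi 'X_i)) -> (forall y, S y -> exists p, psi p = y) ->
  forall y, generated_subring S y <-> exists p, psi p = y.
Proof.
move=> SX Simg y; split=> [|[p <-]].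
  elim=> {y} [|||]; first exact: Simg.
  - by exists 1; rewrite rmorph1.
  - by move=> _ _ _ [p <-] _ [q <-]; exists (p - q); rewrite rmorphB.
  - by move=> _ _ _ [p <-] _ [q <-]; exists (p * q); rewrite rmorphM.
elim/mpoly_int_ind: p => [|p q IHp IHq|p q IHp IHq|i].
- by rewrite rmorph1; apply: generated_one.
- by rewrite rmorphB; apply: generated_sub.
- by rewrite rmorphM; apply: generated_mul.
- exact/generated_gen/SX.
Qed.

Section Image.
Variables (V : finType) (Q : quiver V) (r : nat) (f : V -> 'I_r) (g : 'I_r -> V).
Hypotheses (r_gt0 : (0 < r)%N) (fK : cancel f g) (gK : cancel g f).
Variable ks : seq V.
Let s := foldl (@mutate_seed V) (initial_seed Q) ks.
Hypothesis s_linear : forall v w, seed_quiver s v w = ((f w).+1 == f v :> nat).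

Let sI : alg_independent (seed_cluster s).
Proof. exact/alg_independent_foldl/alg_independent_initial. Qed.

Local Notation ev := (fan_eval (r := r) g (seed_cluster s)).

Lemma fan_params_cluster i : (i <= r)%N ->
  is_cluster_variable Q (fan_params g (seed_cluster s) i).
Proof.
case: i => [_|i lt_ir].
  exists ks, (g (Ordinal r_gt0)).
  by rewrite /fan_params (fan_seq_ord g _ (Ordinal r_gt0)) addr0 divr1.
exists (rcons ks (g (Ordinal lt_ir))), (g (Ordinal lt_ir)).
by rewrite foldl_rcons /= eqxx (exchange_fan fK gK s_linear) gK.
Qed.

Lemma fan_eval_image y :
  generated_subring (is_cluster_variable Q) y <-> exists p, ev p = y.
Proof.
apply: generated_subring_image => {y} [i|y].
  by rewrite /= /fan_eval int_evalX; apply: fan_params_cluster; rewrite -ltnS.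
move=> /(cluster_variable_mutation ks)[ks' [w ->]].
have [lab [apex [T _]]] := triangulated_foldl ks' sI (fan_triangulated fK gK sI s_linear).
by rewrite (triangulation_label T) -(rmorph_chord ev); eexists.
Qed.

Lemma fan_eval_kernel p :
  ev p = 0 <-> exists q, p = q * (chebyshev r.+1 - 1).
Proof.
rewrite chebyshevE; split=> [|[q ->]]; first exact: (fan_eval_ker sI (can_inj gK)).
by rewrite rmorphM /= fan_eval_relation // mulr0.
Qed.

End Image.

Theorem corollary4p5 (r : nat) (hr : (1 <= r)%N) (V : finType) (Q : quiver V)
    (hQ : dynkin_type_A Q r) :
  exists f : {rmorphism cluster_algebra Q -> chebyshev_quotient r},
    bijective f.
Proof.
case: hQ => Q' Q'path [ks0 [f f_bij fE]]; have [g fK gK] := f_bij.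
have [|ks1 lin] := linear_orientation f_bij (Q := foldl (@mutate_quiver V) Q ks0).
  by move=> v w; rewrite !fE Q'path.
have s_linear v w :
    seed_quiver (foldl (@mutate_seed V) (initial_seed Q) (ks0 ++ ks1)) v w
    = ((f w).+1 == f v :> nat).
  by rewrite seed_quiver_foldl foldl_cat -lin.
have img := fan_eval_image hr fK gK s_linear.
have ker := fan_eval_kernel Q gK (ks0 ++ ks1).
exact: cluster_quotient_iso ker img.
Qed.
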